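(* Let $m\ge1$, $k\ge1$ and $h\le k-1$ be integers. The generating function for the number of partitions $\lambda$ of $n$ with an $h$-fixed hook in the $m$th column that arises from a hook of size $k$ (i.e. the row $s=k-h$ satisfies $\lambda_s\ge m$ and $h_{s,m}(\lambda)=k=s+h$) is \[ \sum_{l=1}^{k}\frac{q^{(m-1)(2k-h-l)+k+l(k-h-1)}}{(q;q)_{k-h-1}(q;q)_{m-1}}\binom{k-1}{l-1}_q . \]
   Context: For a partition $\lambda$ with conjugate $\lambda'$, $h_{i,j}(\lambda)=\lambda_i+\lambda'_j-i-j+1$ is the hook length of cell $(i,j)$, $j\le\lambda_i$. An $h$-fixed hook in the $m$th column is a row $i$ with $\lambda_i\ge m$ and $h_{i,m}(\lambda)=i+h$. Notation: $(a;b)_n=\prod_{t=0}^{n-1}(1-ab^t)$, $\binom{a}{b}_q=\frac{(q;q)_a}{(q;q)_b(q;q)_{a-b}}$. *)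

(* Defs.v *)
From HB Require Import structures.
From mathcomp Require Import all_boot all_order all_algebra.
From mathcomp Require Import boolp.

Set Implicit Arguments.
Unset Strict Implicit.
Unset Printing Implicit Defensive.

Import Order.TTheory GRing.Theory Num.Theory.
Local Open Scope ring_scope.

(* Formal power series over R; [f n] is the coefficient of degree n. *)
Record fps (R : Type) := FPS { fps_coef :> nat -> R }.

Lemma fpsP (R : Type) (f g : fps R) : f =1 g -> f = g.
Proof. by case: f g => [f] [g] fg; congr FPS; apply/funext. Qed.

HB.instance Definition _ (R : Type) := gen_eqMixin (fps R).
HB.instance Definition _ (R : Type) := gen_choiceMixin (fps R).

Section FpsZmod.
Variable R : zmodType.
Implicit Types f g : fps R.

Definition fps0 : fps R := FPS (fun=> 0).
Definition fps_opp f : fps R := FPS (fun n => - f n).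
Definition fps_add f g : fps R := FPS (fun n => f n + g n).

Fact fps_addA : associative fps_add.
Proof. by move=> f g h; apply: fpsP => n; rewrite /= addrA. Qed.
Fact fps_addC : commutative fps_add.
Proof. by move=> f g; apply: fpsP => n; rewrite /= addrC. Qed.
Fact fps_add0 : left_id fps0 fps_add.
Proof. by move=> f; apply: fpsP => n; rewrite /= add0r. Qed.
Fact fps_addN : left_inverse fps0 fps_opp fps_add.
Proof. by move=> f; apply: fpsP => n; rewrite /= addNr. Qed.

HB.instance Definition _ :=
  GRing.isNmodule.Build (fps R) fps_addA fps_addC fps_add0.
HB.instance Definition _ := GRing.Nmodule_isZmodule.Build (fps R) fps_addN.

End FpsZmod.

Section FpsRing.
Variable R : comNzRingType.
Implicit Types f g : fps R.

Definition fps1 : fps R := FPS (fun n => (n == 0)%:R).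
Definition fps_mul f g : fps R :=
  FPS (fun n => \sum_(i < n.+1) f i * g (n - i)%N).

Lemma fps_mul_poly (p q : {poly R}) f g n :
    (forall i, (i <= n)%N -> p`_i = f i) ->
    (forall i, (i <= n)%N -> q`_i = g i) ->
  (p * q)`_n = fps_mul f g n.
Proof.
move=> pf qg; rewrite coefM; apply: eq_bigr => i _.
by rewrite pf ?qg ?leq_subr // -ltnS.
Qed.

Let tr n f : {poly R} := \poly_(i < n.+1) f i.

Let trE n f i : (i <= n)%N -> (tr n f)`_i = f i.
Proof. by move=> le_in; rewrite coef_poly ltnS le_in. Qed.

Let trM n f g i : (i <= n)%N -> (tr n f * tr n g)`_i = fps_mul f g i.
Proof.
by move=> le_in; apply: fps_mul_poly => j le_ji; rewrite trE // (leq_trans le_ji).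
Qed.

Fact fps_mulA : associative fps_mul.
Proof.
move=> f g h; apply: fpsP => n.
transitivity (tr n f * tr n g * tr n h)`_n.
  by rewrite -mulrA; apply/esym/fps_mul_poly => i; [exact: trE | exact: trM].
by apply: fps_mul_poly => i; [exact: trM | exact: trE].
Qed.

Fact fps_mulC : commutative fps_mul.
Proof. by move=> f g; apply: fpsP => n; rewrite -!(@trM n) // mulrC. Qed.

Fact fps_mul1 : left_id fps1 fps_mul.
Proof.
move=> f; apply: fpsP => n.
rewrite -[RHS](@trE n) // -[in RHS](mul1r (tr n f)); apply/esym.
by apply: fps_mul_poly => i; [rewrite coef1 | exact: trE].
Qed.

Fact fps_mulDl : left_distributive fps_mul +%R.
Proof.
move=> f g h; apply: fpsP => n /=; rewrite -big_split /=.
by apply: eq_bigr => i _; rewrite mulrDl.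
Qed.

Fact fps1_neq0 : fps1 != 0.
Proof.
by apply/eqP => /(congr1 (fun f : fps R => f 0)) /= /eqP; rewrite oner_eq0.
Qed.

HB.instance Definition _ :=
  GRing.Zmodule_isComNzRing.Build (fps R)
    fps_mulA fps_mulC fps_mul1 fps_mulDl fps1_neq0.

Definition fpsX : fps R := FPS (fun n => (n == 1)%:R).

Lemma fps_coef0 n : (0 : fps R) n = 0. Proof. by []. Qed.
Lemma fps_coef1 n : (1 : fps R) n = (n == 0)%:R. Proof. by []. Qed.
Lemma fps_coefD f g n : (f + g) n = f n + g n. Proof. by []. Qed.
Lemma fps_coefN f n : (- f) n = - f n. Proof. by []. Qed.
Lemma fps_coefM f g n : (f * g) n = \sum_(i < n.+1) f i * g (n - i)%N.
Proof. by []. Qed.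
Lemma fps_coef0M f g : (f * g) 0 = f 0 * g 0.
Proof. by rewrite fps_coefM big_ord1. Qed.

End FpsRing.

Arguments fpsX {R}.

Section FpsUnitRing.
Variable R : comUnitRingType.
Implicit Types f g : fps R.

(* The first n coefficients of the inverse of f, from
   g_0 = f_0^-1 and g_n = - f_0^-1 * \sum_(i < n) f_(i+1) * g_(n-1-i). *)
Fixpoint fps_inv_seq f n : seq R :=
  if n is n'.+1 then
    let s := fps_inv_seq f n' in
    rcons s ((f 0)^-1 * ((n' == 0)%:R - \sum_(i < n') f i.+1 * s`_(n'.-1 - i)))
  else [::].

Definition fps_unit : pred (fps R) := fun f => f 0 \is a GRing.unit.

Definition fps_inv f : fps R :=
  if fps_unit f then FPS (fun n => (fps_inv_seq f n.+1)`_n) else f.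

Let size_inv f n : size (fps_inv_seq f n) = n.
Proof. by elim: n => //= n IHn; rewrite size_rcons IHn. Qed.

Let nth_inv f n i : (i < n)%N ->
  (fps_inv_seq f n)`_i = (fps_inv_seq f i.+1)`_i.
Proof.
elim: n => // n IHn; rewrite ltnS leq_eqVlt => /predU1P[-> // | lt_in].
by rewrite /= !nth_rcons !size_inv lt_in IHn //= nth_rcons size_inv.
Qed.

Fact fps_mulV : {in fps_unit, left_inverse 1 fps_inv *%R}.
Proof.
move=> f Uf; have Uf0 : f 0 \is a GRing.unit by [].
apply: fpsP => n; rewrite mulrC fps_coefM big_ord_recl subn0.
rewrite /fps_inv (Uf : fps_unit f) /=.
rewrite nth_rcons size_inv ltnn eqxx mulVKr // -[RHS]addr0 -addrA; congr (_ + _).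
rewrite addrC; apply/eqP; rewrite subr_eq0; apply/eqP.
apply: eq_bigr => i _; congr (_ * _); case: n i => [[] // | n] i.
rewrite subSS /= [RHS](@nth_inv f n.+1) ?ltnS ?leq_subr //.
Qed.

Fact fps_unitPl f g : g * f = 1 -> fps_unit f.
Proof.
move/(congr1 (fun f : fps R => f 0)); rewrite fps_coef0M => gf1.
by apply/unitrPr; exists (g 0); rewrite mulrC.
Qed.

Fact fps_inv_out : {in [predC fps_unit], fps_inv =1 id}.
Proof. by move=> f; rewrite /fps_inv inE /= => /negPf Uf; rewrite ifF. Qed.

HB.instance Definition _ :=
  GRing.ComNzRing_hasMulInverse.Build (fps R) fps_mulV fps_unitPl fps_inv_out.

Lemma fps_unitE f : (f \is a GRing.unit) = (f 0 \is a GRing.unit).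
Proof. by []. Qed.

End FpsUnitRing.

Definition qpoch (R : pzRingType) (a b : R) (n : nat) : R :=
  \prod_(t < n) (1 - a * b ^+ t).

Definition qbinom (R : unitRingType) (q : R) (a b : nat) : R :=
  qpoch q q a / (qpoch q q b * qpoch q q (a - b)).

Lemma qpoch_fpsX_unit (R : comUnitRingType) n :
  qpoch (fpsX : fps R) fpsX n \is a GRing.unit.
Proof.
rewrite /qpoch; elim/big_ind: _ => [|f g Uf Ug|t _]; first exact: unitr1.
  by rewrite unitrM Uf.
by rewrite fps_unitE fps_coefD fps_coefN fps_coef0M mul0r subr0 unitr1.
Qed.

(* p lists the nonzero parts of a partition of n in non-increasing order. *)
Definition is_intpartn (n : nat) (p : seq nat) : bool :=
  [&& sorted geq p, 0%N \notin p & sumn p == n].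

Record intpartn (n : nat) :=
  IntPartn { intpartn_val :> seq nat; _ : is_intpartn n intpartn_val }.

HB.instance Definition _ n := [isSub for @intpartn_val n].
HB.instance Definition _ n := [Countable of intpartn n by <:].

Section IntPartnFinite.
Variable n : nat.

Let enc (p : intpartn n) : {bseq n of 'I_n.+1} :=
  insub_bseq n [seq inord i | i <- p].
Let dec (b : {bseq n of 'I_n.+1}) : option (intpartn n) :=
  insub [seq val i | i <- b].

Let encK : pcancel enc dec.
Proof.
case=> p pP; rewrite /dec /enc /=; case/and3P: (pP) => _ p_gt0 /eqP sum_p.
have le_mem x : x \in p -> (x <= n)%N.
  rewrite -sum_p; elim: p {pP p_gt0 sum_p} => //= y p IHp.
  rewrite inE => /predU1P[-> | /IHp le_xp]; first exact: leq_addr.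
  exact: leq_trans le_xp (leq_addl _ _).
have size_p : (size p <= n)%N.
  rewrite -sum_p; elim: p p_gt0 {pP sum_p le_mem} => //= y p IHp.
  rewrite inE negb_or eq_sym -lt0n => /andP[y_gt0 /IHp le_p].
  by rewrite -add1n leq_add.
have -> : [seq val i | i <- insub_bseq n [seq (inord i : 'I_n.+1) | i <- p]] = p.
  rewrite /insub_bseq /insubd insubT ?size_map //= -map_comp.
  by rewrite map_id_in => // x /le_mem le_xn /=; rewrite inordK.
by rewrite insubT.
Qed.

HB.instance Definition _ := isFinite.Build (intpartn n) (pcan_enumP encK).

End IntPartnFinite.

(* Rows and columns are numbered from 1. *)
Definition part (p : seq nat) (i : nat) : nat := nth 0%N p i.-1.

Definition conj_part (p : seq nat) (j : nat) : nat := count (leq j) p.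

Definition hook (p : seq nat) (i j : nat) : int :=
  (part p i)%:Z + (conj_part p j)%:Z - i%:Z - j%:Z + 1.

Definition fixed_hook (p : seq nat) (h : int) (m i : nat) : bool :=
  [&& (1 <= i <= size p)%N, (m <= part p i)%N & hook p i m == i%:Z + h].

Definition has_fixed_hook_of_size (p : seq nat) (h : int) (m k : nat) : bool :=
  has (fun i => fixed_hook p h m i && (hook p i m == k%:Z)) (iota 1 (size p)).

Definition fixed_hook_count (h : int) (m k n : nat) : nat :=
  #|[set p : intpartn n | has_fixed_hook_of_size p h m k]|.

(* Main.v *)
Require Import Defs.
From mathcomp Require Import all_boot all_order all_algebra.
From mathcomp Require Import zify ring.

Set Implicit Arguments.
Unset Strict Implicit.
Unset Printing Implicit Defensive.

Import Order.TTheory GRing.Theory Num.Theory.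
Local Open Scope ring_scope.

(* Let l - 1 be the arm length and c = k - l the leg length of the hook in row
   s = k - h and column m, so that row s has length b = m - 1 + l.  The partition
   splits into the s - 1 rows above, all at least b; row s; the c rows of the
   leg, with lengths between m and b; and rows of length at most m - 1.  These
   blocks contribute q^(b(s-1)) / (q;q)_(s-1), q^b, q^(mc) [k-1 choose l-1]_q and
   1 / (q;q)_(m-1), and l ranges over 1, ..., k. *)

(** * Generating functions of classes of partitions *)

Lemma fps_coefXnM (R : comNzRingType) (f : fps R) M n :
  (fpsX ^+ M * f) n = if (n < M)%N then 0 else f (n - M)%N.
Proof.
elim: M n => [|M IHM] n; first by rewrite mul1r subn0.
rewrite exprS -mulrA fps_coefM.
case: n => [|n]; first by rewrite big_ord1 mul0r.
rewrite big_ord_recl mul0r add0r big_ord_recl mul1r big1 ?addr0 => [|i _].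
  by rewrite lift0 subSS subn0 IHM.
by rewrite mul0r.
Qed.

Definition gf (P : pred (seq nat)) : fps int :=
  FPS (fun n => #|[set p : intpartn n | P p]|%:Z).

Lemma intpartnP n (p : intpartn n) : is_intpartn n p.
Proof. by case: p. Qed.

Lemma gf_coef_sum P n : gf P n = \sum_(p : intpartn n) (P p)%:R.
Proof. by rewrite -natr_sum natz /= -sum1dep_card big_mkcond. Qed.

Lemma eq_gf_coef (P Q : pred (seq nat)) n :
  (forall p, is_intpartn n p -> P p = Q p) -> gf P n = gf Q n.
Proof.
by move=> PQ; rewrite !gf_coef_sum; apply: eq_bigr => p _; rewrite PQ ?intpartnP.
Qed.

Lemma eq_gf (P Q : pred (seq nat)) :
    (forall p, sorted geq p -> 0%N \notin p -> P p = Q p) -> gf P = gf Q.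
Proof.
by move=> PQ; apply: fpsP => n; apply: eq_gf_coef => p /and3P[sp p0 _]; apply: PQ.
Qed.

(** Replaces counting in the type [intpartn n] by any duplicate-free list of plain sequences, so
    that bijections can be given by mapping lists. *)
Lemma gf_coef_size (P : pred (seq nat)) n (s : seq (seq nat)) :
    uniq s -> (forall p, (p \in s) = is_intpartn n p && P p) ->
  gf P n = (size s)%:Z.
Proof.
move=> Us sP; rewrite /= cardE -(size_map val); congr (_%:Z); apply/perm_size.
apply: uniq_perm => // [|p]; first by rewrite (map_inj_uniq val_inj) enum_uniq.
rewrite sP; apply/mapP/andP => [[p' + ->]|[pn Pp]].
  by rewrite mem_enum inE intpartnP.
by exists (IntPartn pn); rewrite ?mem_enum ?inE.
Qed.

(** Deleting a first row [M] is a bijection; [path geq M p] records that the row can be put back. *)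
Lemma gf_headE (P : pred (seq nat)) M : (0 < M)%N ->
  gf (fun p => P p && (ohead p == Some M)) =
    fpsX ^+ M * gf (fun p => path geq M p && P (M :: p)).
Proof.
move=> M_gt0; apply: fpsP => n; rewrite fps_coefXnM; case: ltnP => [lt_nM|le_Mn].
  rewrite (@gf_coef_size _ _ [::]) // => -[|x p]; first by rewrite !andbF.
  apply/esym/negbTE; apply/negP=> /andP[/and3P[_ _ /eqP /= pn] /andP[_ /eqP[xM]]].
  by move: lt_nM; rewrite -pn xM ltnNge leq_addr.
set A := [set p : intpartn (n - M) | path geq M p && P (M :: p)].
rewrite (@gf_coef_size _ _ [seq M :: val p | p <- enum A]) /=.
- by rewrite size_map -cardE.
- by rewrite map_inj_uniq ?enum_uniq // => p p' [] /val_inj.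
move=> p; apply/mapP/idP => [[p' + ->]|].
  rewrite mem_enum inE => /andP[sp Pp].
  case/and3P: (intpartnP p') => _ p0 /eqP sn.
  rewrite /is_intpartn /= sp Pp eqxx inE negb_or p0 sn eq_sym -lt0n M_gt0.
  by rewrite subnKC ?eqxx.
case: p => [|x p]; first by rewrite !andbF.
case/andP=> /and3P[/= sp + /eqP sn] /andP[Pp /eqP[xM]].
rewrite inE negb_or xM in sp sn Pp * => /andP[_ p0].
have pn : is_intpartn (n - M) p.
  by rewrite /is_intpartn (path_sorted sp) p0 -sn addKn eqxx.
by exists (IntPartn pn); rewrite // mem_enum inE /= sp.
Qed.

Lemma gf_head (P : pred (seq nat)) M : (0 < M)%N ->
  gf P = gf (fun p => P p && (ohead p != Some M)) +
    fpsX ^+ M * gf (fun p => path geq M p && P (M :: p)).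
Proof.
move=> M_gt0; rewrite -gf_headE //; apply: fpsP => n.
rewrite fps_coefD !gf_coef_sum -big_split; apply: eq_bigr => p _ /=.
by case: (P p); case: eqP.
Qed.

(** Serves to sort partitions by the arm length of the hook, which produces the sum over l. *)
Lemma gf_fibers (P : pred (seq nat)) (f : seq nat -> nat) a b :
    (forall p, P p -> (a <= f p < b)%N) ->
  gf P = \sum_(a <= l < b) gf (fun p => P p && (f p == l)).
Proof.
move=> fab; apply: fpsP => n.
have -> (F : nat -> fps int) : (\sum_(a <= l < b) F l) n = \sum_(a <= l < b) F l n.
  by elim/big_rec2: _ => // l x y _ <-.
under eq_bigr do rewrite gf_coef_sum.
rewrite gf_coef_sum exchange_big; apply: eq_bigr => p _ /=.
case: (boolP (P p)) => [/fab fp|_] /=; last by rewrite big1.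
rewrite (bigD1_seq (f p)) ?iota_uniq ?mem_index_iota //= eqxx big1 ?addr0 //.
by move=> l; rewrite eq_sym => /negPf->.
Qed.

Lemma gf_nilp : gf (@nilp nat) = 1.
Proof.
apply: fpsP => n; rewrite fps_coef1.
rewrite (@gf_coef_size _ _ [seq p <- [:: [::]] | n == 0%N]) ?filter_uniq //.
  by rewrite size_filter /= addn0; case: eqP.
move=> p; rewrite mem_filter inE; case: p => [|x p]; last by rewrite !andbF.
by rewrite /is_intpartn /= eq_sym.
Qed.

(** * Partitions with bounded parts *)

Lemma qpochS (R : pzRingType) (q : R) n :
  qpoch q q n.+1 = qpoch q q n * (1 - q ^+ n.+1).
Proof. by rewrite /qpoch big_ord_recr /= exprS. Qed.

(** Write G_m for the series. Splitting by whether the largest part is m+1 gives G_(m+1) = G_m +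
    q^(m+1) G_(m+1), so each step divides by 1 - q^(m+1). *)
Lemma gf_atmost m : gf (all (geq m)) = (qpoch fpsX fpsX m)^-1.
Proof.
elim: m => [|m IHm].
  rewrite /qpoch big_ord0 invr1 -gf_nilp; apply: eq_gf => -[|x p] //= _.
  by rewrite inE negb_or; case: x.
apply/(mulIr (qpoch_fpsX_unit _ m.+1)); rewrite mulVr ?qpoch_fpsX_unit //.
rewrite qpochS mulrCA mulrBr mulr1 [in X in X - _](gf_head _ (ltn0Sn m)).
have -> : gf (fun p => all (geq m.+1) p && (ohead p != Some m.+1)) =
          gf (all (geq m)).
  apply: eq_gf => -[|x p] //= sp _; rewrite -[Some x == _]/(x == m.+1).
  rewrite andbAC (_ : ((x <= m.+1) && (x != m.+1) = (x <= m))%N); last by lia.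
  have [xm|//] := leqP x m; have /allP px : all (geq x) p.
    by apply: order_path_min sp => a b c /= ba ac; apply: leq_trans ba.
  have /allP pm : {in p, forall y, geq m y}.
    by move=> y /px /= yx; apply: leq_trans yx xm.
  by rewrite pm; apply/allP=> y /(allP pm) /leqW.
have -> : gf (fun p => path geq m.+1 p && all (geq m.+1) (m.+1 :: p)) =
          gf (all (geq m.+1)).
  by apply: eq_gf => -[|x p] /= sp _; rewrite leqnn // sp andbT; case: leq.
by rewrite [X in _ + X - _]mulrC addrK IHm mulrV ?qpoch_fpsX_unit.
Qed.

(** * Blocks of rows confined to a box *)

Definition box (r b e : nat) (Q : pred (seq nat)) : pred (seq nat) :=
  fun p => [&& (r <= size p)%N, all (fun x => b <= x <= e)%N (take r p)
             & Q (drop r p)].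

Lemma sorted_geq_cons x p : sorted geq (x :: p) = all (geq x) p && sorted geq p.
Proof.
apply/idP/andP => [sp|[px sp]]; last by rewrite /= path_min_sorted.
split; last exact: path_sorted sp.
by apply: order_path_min sp => a b c /= ba ac; apply: leq_trans ba.
Qed.

Lemma box_all_le r b e (Q : pred (seq nat)) p :
  (forall p, Q p -> all (geq e) p) -> box r b e Q p -> all (geq e) p.
Proof.
move=> Qe /and3P[_ pe /Qe Qp]; rewrite -(cat_take_drop r p) all_cat Qp andbT.
by apply: sub_all pe => x /andP[].
Qed.

(** A first row of length [e.+1] is deleted; otherwise monotonicity bounds all [r.+1] rows by [e].
    This mirrors the Pascal rule of the q-binomial. *)
Lemma gf_boxS r b e (Q : pred (seq nat)) :
  (b <= e.+1)%N -> (forall p, Q p -> all (geq e.+1) p) ->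
  gf (box r.+1 b e.+1 Q) =
    gf (box r.+1 b e Q) + fpsX ^+ e.+1 * gf (box r b e.+1 Q).
Proof.
move=> le_be Qe; rewrite (gf_head _ (ltn0Sn e)); congr (_ + _ * _).
  apply: eq_gf => -[|x p] //; rewrite sorted_geq_cons => /andP[/allP px _] _.
  rewrite /box /= -[Some x == _]/(x == e.+1) ltnS -!andbA; congr (_ && _).
  case: (leqP b x) => //= bx; have [xe|ex] := leqP x e; last first.
    have [_|/eqP xNe] := x =P e.+1; first by rewrite !andbF.
    by rewrite (_ : (x <= e.+1)%N = false) //; lia.
  rewrite leqW // ltn_eqF ?ltnS // andbT /=; congr (_ && _).
  apply: eq_in_all => y /mem_take /px /= yx.
  by rewrite leqW (leq_trans yx xe).
apply: eq_gf => p sp _; rewrite /box /= le_be leqnn ltnS /=.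
apply: andb_idl => /(box_all_le Qe) pe; by rewrite path_min_sorted.
Qed.

(** In a non-increasing sequence the entries at least [m] form a prefix, so a column height becomes
    a condition on [take] and [drop]. *)
Lemma sorted_countE m c p : sorted geq p ->
  (count (leq m) p == c) =
    [&& (c <= size p)%N, all (leq m) (take c p) & all (gtn m) (drop c p)].
Proof.
elim: p c => [|x p IHp] [|c] //; rewrite sorted_geq_cons => /andP[px sp].
  rewrite /= ltnNge; case: leqP => //= xm; rewrite add0n (IHp 0%N) //.
  by rewrite take0 drop0.
rewrite /= ltnS; case: leqP => /= [mx|xm]; first by rewrite add1n eqSS IHp.
rewrite andbF add0n; apply/eqP; rewrite (@eq_in_count _ _ pred0) ?count_pred0 //.
by move=> y /(allP px) /= yx; rewrite leqNgt (leq_ltn_trans yx).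
Qed.

(** * The q-binomial and its Pascal rule *)

Lemma qpoch0 (R : pzRingType) (q : R) : qpoch q q 0 = 1.
Proof. by rewrite /qpoch big_ord0. Qed.

Section QBinomial.
Variables (R : comUnitRingType) (q : R).
Hypothesis qU : forall n, qpoch q q n \is a GRing.unit.

Lemma qbinomn0 n : qbinom q n 0 = 1.
Proof. by rewrite /qbinom qpoch0 mul1r subn0 divrr. Qed.

Lemma qbinomnn n : qbinom q n n = 1.
Proof. by rewrite /qbinom subnn qpoch0 mulr1 divrr. Qed.

Lemma qbinom_sub a b : (b <= a)%N -> qbinom q a (a - b) = qbinom q a b.
Proof. by move=> le_ba; rewrite /qbinom subKn // [in X in _ / X]mulrC. Qed.

(** Over a common denominator, with x = q^(r+1) and y = q^(d+1), this is 1 - xy = (1 - y) + y(1 -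
    x). *)
Lemma qbinomS d r :
  qbinom q (d.+1 + r.+1) r.+1 =
    qbinom q (d + r.+1) r.+1 + q ^+ d.+1 * qbinom q (d.+1 + r) r.
Proof.
have fracE (x y z : R) : y \is a GRing.unit -> z \is a GRing.unit ->
  x / y = x * z / (y * z) by move=> Uy Uz; rewrite invrM // mulrA mulrK.
have qU1 n : 1 - q ^+ n.+1 \is a GRing.unit.
  by have := qU n.+1; rewrite qpochS unitrM => /andP[].
rewrite /qbinom !addnK -addSnnS !addnS !addSn !qpochS.
rewrite [X in _ = X + _](fracE _ _ (1 - q ^+ d.+1)) ?unitrM ?qU ?qU1 //.
rewrite [X in _ = _ + _ * X](fracE _ _ (1 - q ^+ r.+1)) ?unitrM ?qU ?qU1 //.
set A := qpoch q q r; set B := qpoch q q d; set x := q ^+ r.+1.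
set y := q ^+ d.+1.
have -> : A * (B * (1 - y)) * (1 - x) = A * (1 - x) * (B * (1 - y)) by ring.
rewrite -(mulrA _ B (1 - y)) [y * (_ / _)]mulrA -mulrDl.
congr (_ / _); rewrite (_ : q ^+ _.+2 = x * y); first by ring.
by rewrite -exprD; congr (q ^+ _); lia.
Qed.

End QBinomial.

(** Double induction on [d] and [r], matching the recurrence [gf_boxS] with [qbinomS]; the power of
    q pays for the first [b] cells of each row. *)
Lemma gf_box r b d (Q : pred (seq nat)) :
    (0 < b)%N -> (forall p, Q p -> all (geq b) p) ->
  gf (box r b (b + d)%N Q) = fpsX ^+ (b * r) * qbinom fpsX (d + r) r * gf Q.
Proof.
case: b => // b _ Qb.
have qU n : qpoch (fpsX : fps int) fpsX n \is a GRing.unit.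
  exact: qpoch_fpsX_unit.
have Qbd d' p : Q p -> all (geq (b.+1 + d')%N) p.
  by move=> /Qb; apply: sub_all => x /= /leq_trans; apply; apply: leq_addr.
have box0 e : gf (box 0 b.+1 e Q) = gf Q.
  by apply: eq_gf => p _ _; rewrite /box take0 drop0.
elim: d r => [|d IHd] r.
  rewrite addn0 add0n qbinomnn // mulr1.
  elim: r => [|r IHr]; first by rewrite box0 muln0 mul1r.
  rewrite gf_boxS //.
  (* The upper bound [b] lies below the lower bound [b.+1], so no row fits. *)
  have -> : gf (box r.+1 b.+1 b Q) = 0.
    rewrite -[RHS](mulr0 (fpsX ^+ 0)); apply: fpsP => n.
    rewrite mulr0 fps_coef0 (@gf_coef_size _ _ [::]) // => -[|x p].
      by rewrite andbF.
    rewrite [box _ _ _ _ _](_ : _ = false) ?andbF // /box /=.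
    by rewrite (leqNgt x b); case: (b < x)%N; rewrite andbF.
  by rewrite add0r IHr mulrA -exprD mulnS.
elim: r => [|r IHr]; first by rewrite box0 qbinomn0 // muln0 !mul1r.
rewrite [(b.+1 + _)%N]addnS gf_boxS => [|| p /(Qbd d.+1)]; last 2 first.
- by rewrite leqW ?leq_addr.
- by rewrite addnS.
rewrite IHd -[(b.+1 + d).+1%N]addnS IHr qbinomS // mulnS.
rewrite mulrDr mulrDl; congr (_ + _); rewrite !mulrA -!exprD.
by rewrite addnAC.
Qed.

(** Each extra factor is 1 modulo q^(n+1), which lets the height of a box grow without changing the
    coefficients up to degree n. *)
Lemma qpoch_addn (R : comNzRingType) (q : R) n r :
  exists g, qpoch q q (n + r) = qpoch q q n * (1 + q ^+ n.+1 * g).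
Proof.
elim: r => [|r [g IHr]]; first by exists 0; rewrite addn0 mulr0 addr0 mulr1.
exists (g - q ^+ r * (1 + q ^+ n.+1 * g)).
rewrite addnS qpochS IHr -mulrA -addSn exprD; congr (_ * _); ring.
Qed.

Definition atleast (r b : nat) (Q : pred (seq nat)) : pred (seq nat) :=
  fun p => [&& (r <= size p)%N, all (leq b) (take r p) & Q (drop r p)].

(* In degree n the parts are at most n, so atleast agrees there with a box of
   height n; the q-binomial of that box is 1 / (q; q)_r modulo q ^ n.+1. *)
Lemma gf_atleast r b (Q : pred (seq nat)) :
    (0 < b)%N -> (forall p, Q p -> all (geq b) p) ->
  gf (atleast r b Q) = fpsX ^+ (b * r) / qpoch fpsX fpsX r * gf Q.
Proof.
move=> b_gt0 Qb; apply: fpsP => n.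
rewrite (@eq_gf_coef _ (box r b (b + n)%N Q)) => [|p /and3P[_ _ /eqP sp]].
  rewrite gf_box // /qbinom addnK.
  have [g ->] := qpoch_addn (fpsX : fps int) n r.
  set A := qpoch _ _ n; set B := qpoch _ _ r.
  have -> u : A * u / (B * A) = u / B.
    by rewrite mulrC invrM ?qpoch_fpsX_unit // mulrAC mulKr ?qpoch_fpsX_unit.
  rewrite (_ : fpsX ^+ _ * _ = fpsX ^+ (b * r) / B +
    fpsX ^+ n.+1 * (g * fpsX ^+ (b * r) / B)); last by ring.
  by rewrite mulrDl fps_coefD -(mulrA (fpsX ^+ n.+1)) fps_coefXnM ltnSn addr0.
rewrite /atleast /box; congr [&& _, _ & _]; apply: eq_in_all => x /mem_take px.
rewrite (leq_trans _ (leq_addl b n)) ?andbT // -sp.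
elim: p px {sp} => //= y p IHp; rewrite inE => /predU1P[->|/IHp]; first exact: leq_addr.
by move=> /leq_trans; apply; apply: leq_addl.
Qed.

(** * The hook condition and the decomposition at its row *)

Lemma has_fixed_hook_of_sizeE p m k r :
  has_fixed_hook_of_size p (k%:Z - r.+1%:Z) m k =
    [&& (r < size p)%N, (m <= nth 0%N p r)%N
      & nth 0%N p r + count (leq m) p == k + r + m]%N.
Proof.
rewrite /has_fixed_hook_of_size /fixed_hook /hook /part /conj_part.
apply/hasP/and3P => [[i _ /andP[/and3P[ip mi hi] ki]]|[rp mr /eqP hr]].
  (* Both i + h = k and h = k - (r + 1) hold, so only row r + 1 can carry the hook. *)
  have ir : i = r.+1 by lia.
  by rewrite {}ir /= in ip mi ki *; split=> //; lia.
exists r.+1; first by rewrite mem_iota; lia.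
by rewrite /= rp mr /=; lia.
Qed.

Definition head_row (b : nat) (Q : pred (seq nat)) : pred (seq nat) :=
  fun p => if p is x :: p' then (x == b) && Q p' else false.

Lemma gf_head_row b (Q : pred (seq nat)) :
    (0 < b)%N -> (forall p, Q p -> all (geq b) p) ->
  gf (head_row b Q) = fpsX ^+ b * gf Q.
Proof.
move=> b_gt0 Qb.
transitivity (gf (fun p => Q (behead p) && (ohead p == Some b))).
  by apply: eq_gf => -[|x p] _ _ /=; rewrite ?andbF // andbC.
rewrite (gf_headE (fun p => Q (behead p))) //; congr (_ * _).
apply: eq_gf => p sp _ /=; apply: andb_idl => /Qb pb.
by rewrite path_min_sorted.
Qed.

(* Here m, l and (l + c).+1 stand for m - 1, l - 1 and k in the theorem, so l is
   the arm length and c the leg length of the hook. *)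
Lemma fixed_hook_decomp p m l c r : sorted geq p ->
  (has_fixed_hook_of_size p ((l + c).+1%:Z - r.+1%:Z) m.+1 (l + c).+1
     && (nth 0%N p r - m == l.+1))%N =
  atleast r (m.+1 + l)
    (head_row (m.+1 + l) (box c m.+1 (m.+1 + l) (all (geq m)))) p.
Proof.
move=> sp; have sp2 := drop_sorted r.+1 sp.
rewrite has_fixed_hook_of_sizeE /atleast.
have [rp|pr] := ltnP r (size p); last first.
  by rewrite drop_oversize // !andbF.
rewrite (ltnW rp) (drop_nth 0%N rp) /=; move: sp; set x := nth _ _ _.
rewrite -[in sorted _ _](cat_take_drop r.+1 p) (take_nth 0%N rp) -/x cat_rcons.
rewrite -[in count _ _](cat_take_drop r.+1 p) (take_nth 0%N rp) -/x cat_rcons.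
have sz1 : size (take r p) = r by rewrite size_takel // ltnW.
set p1 := take r p in sz1 *; set p2 := drop r.+1 p in sp2 *.
(* Pairwise order across the cut: rows above are at least [x], rows below at most [x]. *)
rewrite (@sorted_pairwise _ _ (rev_trans leq_trans)) pairwise_cat allrel_consr.
rewrite pairwise_cons.
case/and3P=> /andP[p1x _] _ /andP[p2x _].
have [xE|xN] := x =P (m.+1 + l)%N; last first.
  rewrite andbF; apply/negP=> /andP[/andP[mx _] xl]; case: xN; lia.
have mx : (m < x)%N by lia.
(* The rows above all reach column m + 1, so its height is r + 1 plus the leg, and the hook size
   then forces the leg to be [c]. *)
have p1m : count (leq m.+1) p1 = r.
  apply/eqP; rewrite -sz1 -all_count.
  by apply: sub_all p1x => y /= /(leq_trans mx).
have p1b : all (leq (m.+1 + l)) p1 by rewrite -xE; apply: sub_all p1x.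
rewrite p1b mx count_cat /= mx p1m /=.
rewrite (_ : (x - m == l.+1)%N) ?andbT; last by lia.
rewrite (_ : (_ == _) = (count (leq m.+1) p2 == c)); last by lia.
rewrite sorted_countE // /box; congr [&& _, _ & _].
by apply: eq_in_all => y /mem_take /(allP p2x) /= yx; rewrite -xE yx andbT.
Qed.

Theorem theorem3p2 (m k : nat) (h : int) (m_ge1 : (1 <= m)%N) (k_ge1 : (1 <= k)%N)
    (h_le : h <= k%:Z - 1) :
  let q : fps int := fpsX in
  FPS (fun n => (fixed_hook_count h m k n)%:Z) =
  \sum_(1 <= l < k.+1)
     q ^ ((m%:Z - 1) * (2 * k%:Z - h - l%:Z) + k%:Z + l%:Z * (k%:Z - h - 1))
     / (qpoch q q `|(k%:Z - h - 1)%R|%N * qpoch q q (m - 1)%N)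
     * qbinom q (k - 1)%N (l - 1)%N.
Proof.
case: m m_ge1 => // m _; case: k k_ge1 h_le => // k _ h_le /=.
(* [k] is now one less than the hook size; r = s - 1 counts the rows above row s. *)
have [r ->] : exists r : nat, h = k.+1%:Z - r.+1%:Z.
  by exists `|(k%:Z - h)%R|%N; lia.
have -> : `|(k.+1%:Z - (k.+1%:Z - r.+1%:Z) - 1)%R|%N = r by lia.
rewrite !subn1 /=.
pose P := fun p => has_fixed_hook_of_size p (k.+1%:Z - r.+1%:Z) m.+1 k.+1.
(* As [m] is now one less than the column, [f p] is the arm length plus one, that is, l. *)
pose f p := (nth 0%N p r - m)%N.
(* The bounds on [f] use the order of the rows, and [gf_fibers] sees only the predicate, so
   sortedness is put into it. *)
rewrite -[LHS]/(gf P); transitivity (gf (fun p => sorted geq p && P p)).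
  by apply: eq_gf => p sp _; rewrite sp.
rewrite (@gf_fibers _ f 1 k.+2) => [|p /andP[sp]]; last first.
  rewrite /P has_fixed_hook_of_sizeE => /and3P[rp mr /eqP hr].
  (* Column m + 1 has height at least r + 1, which caps [f p] at the hook size. *)
  suff : (r < count (leq m.+1) p)%N by rewrite /f; lia.
  rewrite -(cat_take_drop r.+1 p) count_cat.
  have /eqP-> : count (leq m.+1) (take r.+1 p) == r.+1.
    rewrite -[X in _ == X](size_takel rp) -all_count (take_nth 0%N rp).
    rewrite all_rcons mr; move: sp.
    rewrite -[in sorted _ _](cat_take_drop r.+1 p) (take_nth 0%N rp) cat_rcons.
    rewrite (@sorted_pairwise _ _ (rev_trans leq_trans)) pairwise_cat.
    rewrite allrel_consr => /and3P[/andP[+ _] _ _].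
    by apply: sub_all => y /= /(leq_trans mr).
  exact: leq_addr.
rewrite !big_add1 /= !big_mkord; apply: eq_bigr => -[l lk] _ /=.
have [c kE] : exists c, k = (l + c)%N by exists (k - l)%N; lia.
rewrite {}kE in P lk *.
have le_m e p : all (geq m) p -> (m <= e)%N -> all (geq e) p.
  by move=> pm me; apply: sub_all pm => x /= /leq_trans; apply.
transitivity (gf (atleast r (m.+1 + l)
    (head_row (m.+1 + l) (box c m.+1 (m.+1 + l) (all (geq m)))))).
  apply: eq_gf => p sp _; rewrite sp; exact: fixed_hook_decomp.
have box_le p : box c m.+1 (m.+1 + l) (all (geq m)) p ->
    all (geq (m.+1 + l)%N) p.
  by apply: box_all_le => p' /le_m; apply; lia.
rewrite gf_atleast // => [|[|x p] //= /andP[/eqP-> /box_le->]]; last first.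
  by rewrite leqnn.
rewrite gf_head_row // gf_box // => [|p /le_m]; last by apply.
rewrite gf_atmost.
(* The box selects by leg, the formula by arm; symmetry exchanges them. *)
have -> : qbinom fpsX (l + c) c = qbinom (fpsX : fps int) (l + c) l.
  by rewrite -[RHS]qbinom_sub ?leq_addr // addKn.
set e := (X in fpsX ^ X).
(* The integer exponent is the sum of the powers of q from the rows above, row s and the leg. *)
have -> : e = ((m.+1 + l) * r + (m.+1 + l) + m.+1 * c)%N by rewrite /e; lia.
rewrite subn1 -exprnP (exprD _ (_ + _)) (exprD _ (_ * _)).
by rewrite invrM ?qpoch_fpsX_unit // -[l.+1.-1]/l; ring.
Qed.
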